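(* Let $J$ be an interval with left endpoint $0\in J$, let $\mathcal{T}:J\to\mathbb{R}^{2\times2}$ be symmetric-matrix valued and of class $C^k$ with $k$ sufficiently large, and let $\mathcal{D}$ solve $\ddot{\mathcal{D}}=\mathcal{T}\mathcal{D}$, $\mathcal{D}(0)=0$, $\dot{\mathcal{D}}(0)=I$. Let $\lambda_c>0$ be an interior point of $J$ which is a non-degenerate conjugate point, i.e. $\mathcal{D}(\lambda_c)$ has rank $1$, and let the coordinate frame be oriented such that $\Gamma(\lambda_c)=\Lambda(\lambda_c)=:\Lambda_c\neq0$. Let $a,b\in\mathbb{C}$ be the unique numbers with $\dot\Lambda(\lambda_c)=a\Lambda_c$ and $\dot\Gamma(\lambda_c)=b\Lambda_c$, put $\epsilon=\lambda-\lambda_c$, and write $\mathcal{R}_c=\mathcal{R}(\lambda_c)$, $\mathcal{F}_c=\mathcal{F}(\lambda_c)$. Then $\operatorname{Im}(a+b)=0$ (so that $\operatorname{Re}(a-b)=a-b^*$), $\operatorname{Re}(a-b)\neq0$, and near $\epsilon=0$: $$\Lambda=\Big[1+a\epsilon+\tfrac12\epsilon^2(\mathcal{R}_c-\mathcal{F}_c)\Big]\Lambda_c+O(\epsilon^3),\qquad \Gamma=\Big[1+b\epsilon+\tfrac12\epsilon^2(\mathcal{R}_c-\mathcal{F}_c^* )\Big]\Lambda_c+O(\epsilon^3),$$ $$\det\mathcal{D}=2\operatorname{Re}(a-b)\,|\Lambda_c|^2\,\epsilon+\big(|a|^2-|b|^2\big)|\Lambda_c|^2\,\epsilon^2+O(\epsilon^3),$$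 so the leading order of $\det\mathcal{D}$ is one; $$\theta=\frac1{2\epsilon}\Big[1+\frac{|a|^2-|b|^2}{2\operatorname{Re}(a-b)}\,\epsilon+O(\epsilon^2)\Big],\qquad \sigma=\frac1{2\epsilon}\Big[1-\frac{|a|^2-|b|^2}{2\operatorname{Re}(a-b)}\,\epsilon+O(\epsilon^2)\Big];$$ hence in the chosen frame $\sigma$ is real through zeroth order in $\epsilon$, and it becomes imaginary (acquires a non-zero imaginary part) in first order in $\epsilon$ if and only if $\mathcal{F}_c$ is not real. Moreover $$w=|\Lambda_c|\operatorname{sign}\big(\operatorname{Re}(a-b)\,\epsilon\big)\sqrt{|2\operatorname{Re}(a-b)\,\epsilon|}\,\big(1+O(\epsilon^2)\big),$$ or, with $\mathrm{d}_c=\frac{d}{d\lambda}\det\mathcal{D}\big|_{\lambda_c}$, $$w=\operatorname{sign}(\mathrm{d}_c\,\epsilon)\sqrt{|\mathrm{d}_c\,\epsilon|}\,\big(1+O(\epsilon^2)\big).$$ Thus at a non-degenerate conjugate point $w$ is continuous, changes its sign, and has an infinite first derivative.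
   Context: Dots denote $d/d\lambda$, and $^*$ is complex conjugation. For a real $2\times2$ matrix $A=(a_{ij})$ put $$\Lambda[A]=\tfrac12(a_{11}+a_{22})+\tfrac{i}{2}(a_{12}-a_{21}),\qquad \Gamma[A]=\tfrac12(a_{11}-a_{22})+\tfrac{i}{2}(a_{12}+a_{21}),$$ so that $\det A=|\Lambda[A]|^2-|\Gamma[A]|^2$; write $\Lambda(\lambda)=\Lambda[\mathcal{D}(\lambda)]$, $\Gamma(\lambda)=\Gamma[\mathcal{D}(\lambda)]$. The real function $\mathcal{R}$ (source of convergence) and the complex function $\mathcal{F}$ (source of shear) are defined by $$\mathcal{T}=\begin{pmatrix}\mathcal{R}-\operatorname{Re}\mathcal{F}&\operatorname{Im}\mathcal{F}\\ \operatorname{Im}\mathcal{F}&\mathcal{R}+\operatorname{Re}\mathcal{F}\end{pmatrix}.$$ A constant rotation of the coordinate frame replaces $\mathcal{D},\mathcal{T}$ by $R^{-1}\mathcal{D}R$, $R^{-1}\mathcal{T}R$ with $R=\begin{pmatrix}\cos\vartheta&\sin\vartheta\\-\sin\vartheta&\cos\vartheta\end{pmatrix}$; it leaves $\Lambda$ unchanged and multiplies $\Gamma$ by $e^{2i\vartheta}$, so at a non-degenerate conjugate point (where $|\Gamma|=|\Lambda|\ne0$) one may orient the frame such that $\Gamma=\Lambda$; $\mathcal{F}$ and $\sigma$ refer to this frame. Wherever $\mathcal{D}$ is invertible, the optical deformation matrix is $\mathcal{S}=\dot{\mathcal{D}}\mathcal{D}^{-1}$, which is symmetric, and the optical scalars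 $\theta\in\mathbb{R}$, $\sigma\in\mathbb{C}$ are defined by $$\mathcal{S}=\begin{pmatrix}\theta-\operatorname{Re}\sigma&\operatorname{Im}\sigma\\ \operatorname{Im}\sigma&\theta+\operatorname{Re}\sigma\end{pmatrix}.$$ Further $w(\lambda)=\operatorname{sign}(\det\mathcal{D}(\lambda))\sqrt{|\det\mathcal{D}(\lambda)|}$.
   Formalization: In both formulas for w the factor 1+O(ε²) is false in general (e.g. T=diag(0,−1), λ_c=π) and is replaced by 1+(κ/2)ε+O(ε²) with κ=(|a|²−|b|²)/(2Re(a−b)); this is the printed formula when |a|=|b|. *)

(* Defs.v *)
From HB Require Import structures.
From mathcomp Require Import all_boot all_order all_algebra.
From mathcomp Require Import complex.
From mathcomp Require Import ring lra.
From mathcomp Require Import all_classical all_reals all_analysis.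

Set Implicit Arguments.
Unset Strict Implicit.
Unset Printing Implicit Defensive.

Import Order.TTheory GRing.Theory Num.Theory.
Import numFieldNormedType.Exports.

Local Open Scope classical_set_scope.
Local Open Scope ring_scope.
Local Open Scope complex_scope.

Section Defs.
Variable R : realType.

Definition Lam (A : 'M[R]_2) : R[i] :=
  ((A 0 0 + A 1 1) / 2) +i* ((A 0 1 - A 1 0) / 2).

Definition Gam (A : 'M[R]_2) : R[i] :=
  ((A 0 0 - A 1 1) / 2) +i* ((A 0 1 + A 1 0) / 2).

(* The symmetric matrix
     [ r - Re z     Im z   ]
     [   Im z     r + Re z ]
   which relates T to (R, F) and S to (theta, sigma). *)
Definition optical_mx (r : R) (z : R[i]) : 'M[R]_2 :=
  \matrix_(i, j) (if i != j then complex.Im z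
                  else if i == 0 then r - complex.Re z else r + complex.Re z).

(* The two coordinates of a symmetric matrix in the above form; see
   [optical_mxE] and [optical_mx_inj]. *)
Definition convergence (A : 'M[R]_2) : R := (A 0 0 + A 1 1) / 2.
Definition shear (A : 'M[R]_2) : R[i] := ((A 1 1 - A 0 0) / 2) +i* (A 0 1).

Lemma optical_mxE (A : 'M[R]_2) :
  A^T = A <-> A = optical_mx (convergence A) (shear A).
Proof.
split=> [symA|->]; last first.
  by apply/matrixP => i j; rewrite !mxE eq_sym; case: (eqVneq i j) => [->|].
have A10 : A 1 0 = A 0 1 by rewrite -[in LHS]symA mxE.
apply/matrixP => i j; rewrite mxE /convergence /shear /=.
have halfB (x y : R) : (x + y) / 2 - (y - x) / 2 = x by field.
have halfD (x y : R) : (x + y) / 2 + (y - x) / 2 = y by field.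
case: i => [[|[|//]] hi]; case: j => [[|[|//]] hj] /=.
- by rewrite halfB; congr (A _ _); apply: val_inj.
- by congr (A _ _); apply: val_inj.
- by rewrite -A10; congr (A _ _); apply: val_inj.
- by rewrite halfD; congr (A _ _); apply: val_inj.
Qed.

Lemma optical_mx_inj (r r' : R) (z z' : R[i]) :
  optical_mx r z = optical_mx r' z' -> r = r' /\ z = z'.
Proof.
case: z z' => [x y] [x' y'] /matrixP e.
have := e 0 0; have := e 0 1; have := e 1 1; rewrite !mxE /= => e1 -> e0.
by split; [lra | congr (_ +i* _); lra].
Qed.

(* f' is the derivative of f on J, where at each point of J the difference
   quotient is taken in J, hence one-sided at an endpoint of an interval J. *)
Definition is_derive_on (J : set R) (f f' : R -> 'M[R]_2) : Prop :=
  forall x, J x ->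
    (fun y => (y - x)^-1 *: (f y - f x)) @ within J x^' --> f' x.

Fixpoint C_on (k : nat) (J : set R) (f : R -> 'M[R]_2) : Prop :=
  match k with
  | 0 => {within J, continuous f}
  | m.+1 => exists2 f', is_derive_on J f f' & C_on m J f'
  end.

(* R[i] carries a norm and a topology, over itself, only through its alias
   R[i]^o; [toC] makes these available to limits and Landau notations. *)
Definition toC (f : R -> R[i]) : R -> R[i]^o := f.

Definition is_cderive (f : R -> R[i]) (x : R) (l : R[i]) : Prop :=
  toC (fun y => ((y - x)^-1)%:C * (f y - f x)) @ x^' --> (l : R[i]^o).

Definition has_leading_order (f : R -> R) (x : R) (n : nat) : Prop :=
  exists2 c : R, c != 0 & (fun y => f y / (y - x) ^+ n) @ x^' --> c.

Definition signed_sqrt (d : R) : R := Num.sg d * Num.sqrt `|d|.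

End Defs.

(* Main.v *)
Require Import Defs.
From HB Require Import structures.
From mathcomp Require Import all_boot all_order all_algebra.
From mathcomp Require Import complex.
From mathcomp Require Import ring lra.
From mathcomp Require Import all_classical all_reals all_analysis.

(* Write eps = lambda - lambda_c.  Symmetry of T makes the Wronskian
   D^T D' - D'^T D constant, hence zero, because D(0) = 0; at lambda_c this reads
   Im (a + b) = 0.  In the chosen frame the second row of D(lambda_c) vanishes,
   and Re (a - b) = 0 would make both D and D' annihilate a nonzero vector v at
   lambda_c; by uniqueness for the linear equation (a Gronwall estimate run
   backwards) D v would vanish identically, against D'(0) = I.

   Since D'' = T D is Lipschitz at lambda_c, the entries of D and D' have Taylor
   expansions up to O(eps^3) and O(eps^2), so
     det D = Q eps + P eps^2 + O(eps^3),  Q = 2 Re (a - b) |L|^2 != 0,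
     P = det D'(lambda_c) = (|a|^2 - |b|^2) |L|^2.
   By Cramer's rule the entries of S = D' D^-1 are quotients by det D of
   expressions in the entries of D and D'.  The off-diagonal one,
   D'_01 D_00 - D'_00 D_01, vanishes at lambda_c and has derivative T_01 det D,
   so it is T_01 Q eps^2 / 2 + O(eps^3): this gives Im sigma one more order than
   the other entries and ties it to Im F_c.  Finally w is the product of the
   signed square root of Q eps and sqrt (1 + (P / Q) eps + O(eps^2)). *)

Set Implicit Arguments.
Unset Strict Implicit.
Unset Printing Implicit Defensive.

Import Order.TTheory GRing.Theory Num.Theory.
Import numFieldNormedType.Exports.
Import ComplexField.Normc.

Local Open Scope classical_set_scope.
Local Open Scope ring_scope.
Local Open Scope complex_scope.
(** * Expansions at a point *)

Section Asymptotics.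
Variables (R : realType) (c : R).
Implicit Types (f g : R -> R) (n m : nat).

(** The bound also holds at [c] itself: it forces [f c = 0] for [0 < n], while [Oeps 0] is local
    boundedness, as [0 ^+ 0 = 1]. *)
Definition Oeps n f : Prop :=
  exists K : R, \forall x \near c, `|f x| <= K * `|x - c| ^+ n.

Lemma Oeps_near n f g : (\forall x \near c, f x = g x) -> Oeps n f -> Oeps n g.
Proof.
move=> fg [K fK]; exists K; near=> x.
by rewrite -(near fg x)//; exact: (near fK x).
Unshelve. all: by end_near. Qed.

Lemma Oeps_ext n f g : f =1 g -> Oeps n f -> Oeps n g.
Proof. by move=> fg; apply: Oeps_near; near=> x. Unshelve. all: by end_near. Qed.

Lemma near_dist_lt (e : R) : 0 < e -> \forall x \near c, `|x - c| < e.
Proof. by move=> e0; exists e => // x /=; rewrite distrC. Qed.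

Lemma Oeps_ge0 n f : Oeps n f ->
  exists2 K : R, 0 <= K & \forall x \near c, `|f x| <= K * `|x - c| ^+ n.
Proof.
move=> [K fK]; exists `|K| => //; near=> x.
apply: le_trans (near fK x _) _ => //.
by rewrite ler_wpM2r ?exprn_ge0// ler_norm.
Unshelve. all: by end_near. Qed.

Lemma Oeps_le m n f : (m <= n)%N -> Oeps n f -> Oeps m f.
Proof.
move=> mn /Oeps_ge0[K K0 fK]; exists K; near=> x.
apply: le_trans (near fK x _) _ => //.
rewrite ler_wpM2l// ler_wiXn2l//; apply: ltW; near: x; exact: near_dist_lt.
Unshelve. all: by end_near. Qed.

Lemma OepsD n f g : Oeps n f -> Oeps n g -> Oeps n (fun x => f x + g x).
Proof.
move=> [K fK] [L gL]; exists (K + L); near=> x.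
rewrite mulrDl; apply: le_trans (ler_normD _ _) _.
by apply: lerD; [near: x; exact: fK|near: x; exact: gL].
Unshelve. all: by end_near. Qed.

Lemma OepsM m n f g : Oeps m f -> Oeps n g -> Oeps (m + n) (fun x => f x * g x).
Proof.
move=> [K fK] [L gL]; exists (K * L); near=> x.
by rewrite normrM exprD mulrACA ler_pM//; near: x; [exact: fK|exact: gL].
Unshelve. all: by end_near. Qed.

Lemma Oeps_cst (k : R) : Oeps 0 (fun=> k).
Proof. by exists `|k|; near=> x; rewrite mulr1. Unshelve. all: by end_near. Qed.

Lemma Oeps_eps n : Oeps n (fun x => (x - c) ^+ n).
Proof. by exists 1; near=> x; rewrite mul1r normrX. Unshelve. all: by end_near. Qed.

Lemma OepsZ n (k : R) f : Oeps n f -> Oeps n (fun x => k * f x).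
Proof. by move=> fO; have := OepsM (Oeps_cst k) fO. Qed.

Lemma OepsB n f g : Oeps n f -> Oeps n g -> Oeps n (fun x => f x - g x).
Proof.
move=> fO gO; apply: Oeps_ext (OepsD fO (OepsZ (-1) gO)) => x.
by rewrite mulN1r.
Qed.

Lemma OepsMb n f g : Oeps 0 f -> Oeps n g -> Oeps n (fun x => f x * g x).
Proof. exact: OepsM. Qed.

(** Locating the intermediate point only by its distance to [c] treats both sides of [c] at once. *)
Lemma MVT_dist f g x :
  (forall y, `|y - c| <= `|x - c| -> is_derive (y : R) (1 : R) f (g y)) ->
  exists2 y, `|y - c| <= `|x - c| & f x - f c = g y * (x - c).
Proof.
move=> fg; have cf y : `|y - c| <= `|x - c| -> {for y, continuous f}.
  move=> /fg[fy _]; apply: differentiable_continuous.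
  exact/derivable1_diffP.
case: (ltgtP x c) => [xc|cx|->]; last first.
- by exists c; rewrite ?subrr ?normr0// mulr0.
- have yx y : y \in `[c, x] -> `|y - c| <= `|x - c|.
    rewrite in_itv/= => /andP[xy yc].
    by rewrite !ger0_norm ?subr_ge0 ?(ltW cx)// lerB.
  have [y /subset_itv_oo_cc/yx/fg//||y /subset_itv_oo_cc/yx] := MVT cx (df := g) (f := f).
    by apply: continuous_in_subspaceT => y; rewrite inE/= => /yx/cf.
  by exists y.
- have yx y : y \in `[x, c] -> `|y - c| <= `|x - c|.
    rewrite in_itv/= => /andP[xy yc].
    by rewrite !ler0_norm ?subr_le0 ?(ltW xc)// lerN2 lerB.
  have [y /subset_itv_oo_cc/yx/fg//||y /subset_itv_oo_cc/yx] := MVT xc (df := g) (f := f).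
    by apply: continuous_in_subspaceT => y; rewrite inE/= => /yx/cf.
  by move=> yxc e; exists y => //; rewrite -[LHS]opprB e -mulrN opprB.
Qed.

(** By the mean value theorem [f x] is [g y * (x - c)] with [y] no farther from [c] than [x], so one
    order is gained without integrating. *)
Lemma Oeps_primitive n f g :
  (\forall x \near c, is_derive (x : R) (1 : R) f (g x)) ->
  f c = 0 -> Oeps n g -> Oeps n.+1 f.
Proof.
move=> fg fc0 /Oeps_ge0[K K0 gK].
have [/= e e0 He] := filterI fg gK.
exists K; exists e => // x; rewrite /ball_/= distrC => xe.
have fgK y : `|y - c| <= `|x - c| -> 
    is_derive (y : R) (1 : R) f (g y) /\ `|g y| <= K * `|y - c| ^+ n.
  by move=> yx; apply: He; rewrite /= distrC; exact: le_lt_trans yx xe.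
have [y yx] := @MVT_dist f g x (fun y yx => proj1 (fgK y yx)).
rewrite fc0 subr0 => ->; rewrite normrM exprSr mulrA ler_wpM2r//.
apply: le_trans (proj2 (fgK y yx)) _ => //.
by rewrite ler_wpM2l// lerXn2r ?nnegrE.
Qed.

Lemma is_derive1_cvgP f l : is_derive (c : R) (1 : R) f l <->
  (fun y => (y - c)^-1 * (f y - f c)) @ c^' --> l.
Proof.
have shiftE : (fun h : R => h^-1 *: ((f \o shift c) (h *: (1 : R)) - f c)) @ 0^' =
    (fun y => (y - c)^-1 * (f y - f c)) @ c^'.
  apply/funext => P.
  change ((\forall h \near (0 : R), h != 0 ->
      P (h^-1 * (f (h * 1 + c) - f c))) =
    (\forall y \near c, y != c -> P ((y - c)^-1 * (f y - f c)))).
  rewrite (near_shift 0 c); congr (nbhs _ _); apply/funext => h /=.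
  by rewrite subr0 mulr1 addrK -[h + c == c]subr_eq0 addrK.
split=> [[df <-]|fl].
  by rewrite -shiftE; exact: df.
rewrite -shiftE in fl.
by apply: DeriveDef; [apply/cvg_ex; exists l|apply: cvg_lim].
Qed.

Lemma Oeps_derive f l : is_derive (c : R) (1 : R) f l ->
  Oeps 1 (fun x => f x - f c).
Proof.
move=> /is_derive1_cvgP fl; exists (`|l| + 1).
have : \forall x \near c^', `|(x - c)^-1 * (f x - f c)| <= `|l| + 1.
  near=> x; rewrite -lerBlDl (le_trans (lerB_dist _ _))//.
  by near: x; apply: cvgr_distC_le fl _ _.
rewrite near_withinE; apply: filterS => x.
have [->|xc /(_ isT)] := eqVneq x c; first by rewrite !subrr normr0 mulr0.
by rewrite normrM normfV ler_pdivrMl ?normr_gt0 ?subr_eq0// mulrC.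
Unshelve. all: by end_near. Qed.

(** The order [n] of the error is independent of the degree of the polynomial; for [n <= 2] the
    coefficient [d] carries no information, see [jet_quad]. *)
Definition jet n f (a b d : R) : Prop :=
  Oeps n (fun x => f x - (a + b * (x - c) + d * (x - c) ^+ 2)).

Lemma jet_le m n f a b d : (m <= n)%N -> jet n f a b d -> jet m f a b d.
Proof. exact: Oeps_le. Qed.

Lemma jet_near n f g a b d :
  (\forall x \near c, f x = g x) -> jet n f a b d -> jet n g a b d.
Proof.
move=> fg; apply: Oeps_near; near=> x; congr (_ - _); near: x; exact: fg.
Unshelve. all: by end_near. Qed.

Lemma jet_eq n f a b d a' b' d' :
  jet n f a b d -> a = a' -> b = b' -> d = d' -> jet n f a' b' d'.
Proof. by move=> + <- <- <-. Qed.

Lemma jet_quad n f a b d d' : (n <= 2)%N -> jet n f a b d -> jet n f a b d'.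
Proof.
move=> n2 jf; apply: Oeps_ext (OepsD jf (Oeps_le n2 (OepsZ (d - d') (Oeps_eps 2)))) => x.
by ring.
Qed.

Lemma jet_eq1 n f a b d a' b' d' : (n <= 2)%N ->
  jet n f a b d -> a = a' -> b = b' -> jet n f a' b' d'.
Proof. by move=> n2 jf <- <-; exact: jet_quad jf. Qed.

Lemma jet_poly n a b d : jet n (fun x => a + b * (x - c) + d * (x - c) ^+ 2) a b d.
Proof. by exists 0; near=> x; rewrite subrr normr0 mul0r. Unshelve. all: by end_near. Qed.

Lemma jet0O n f a b d : jet n f a b d -> Oeps 0 f.
Proof.
move=> /(Oeps_le (leq0n _)) jf.
apply: Oeps_ext (OepsD jf (OepsD (OepsD (Oeps_cst a) (Oeps_le _ (OepsZ b (Oeps_eps 1))))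
  (Oeps_le _ (OepsZ d (Oeps_eps 2))))) => // x.
by ring.
Qed.

Lemma jetD n f g a b d a' b' d' : jet n f a b d -> jet n g a' b' d' ->
  jet n (fun x => f x + g x) (a + a') (b + b') (d + d').
Proof. by move=> jf jg; apply: Oeps_ext (OepsD jf jg) => x; ring. Qed.

Lemma jetZ n k f a b d : jet n f a b d ->
  jet n (fun x => k * f x) (k * a) (k * b) (k * d).
Proof. by move=> jf; apply: Oeps_ext (OepsZ k jf) => x; ring. Qed.

Lemma jetB n f g a b d a' b' d' : jet n f a b d -> jet n g a' b' d' ->
  jet n (fun x => f x - g x) (a - a') (b - b') (d - d').
Proof. by move=> jf jg; apply: Oeps_ext (OepsB jf jg) => x; ring. Qed.

(** With [P], [P'] the two polynomials, [f g - P P' = g (f - P) + P (g - P')]; truncating [P P']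
    drops only cubic and quartic terms, whence [n <= 3]. *)
Lemma jetM n f g a b d a' b' d' : (n <= 3)%N ->
  jet n f a b d -> jet n g a' b' d' ->
  jet n (fun x => f x * g x) (a * a') (a * b' + b * a') (a * d' + b * b' + d * a').
Proof.
move=> n3 jf jg.
have := OepsD (OepsMb (jet0O jg) jf) (OepsMb (jet0O (jet_poly 0 a b d)) jg).
have jh := OepsMb (jet0O (jet_poly 0 (b * d' + d * b') (d * d') 0))
  (Oeps_le n3 (Oeps_eps 3)).
by move=> /OepsD/(_ jh); apply: Oeps_ext => x; ring.
Qed.

Lemma Oeps_cvg0 f : Oeps 1 f -> f @ c --> 0.
Proof.
move=> /Oeps_ge0[K K0 fK]; apply/cvgrPdist_le => /= e e0.
have K1 : 0 < K + 1 by rewrite ltr_wpDl.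
near=> x; rewrite sub0r normrN (le_trans (near fK x _))// expr1.
have : `|x - c| < e / (K + 1) by near: x; apply: near_dist_lt; rewrite divr_gt0.
rewrite ltr_pdivlMr// mulrDr mulr1 => /ltW; apply: le_trans.
by rewrite mulrC lerDl.
Unshelve. all: by end_near. Qed.

Lemma jet_cvg n f a b d : (0 < n)%N -> jet n f a b d -> f @ c --> a.
Proof.
move=> n0 jf.
have jf1 : Oeps 1 (fun x => f x - a).
  apply: Oeps_ext (OepsD (Oeps_le n0 jf) (OepsD (OepsZ b (Oeps_eps 1))
    (Oeps_le _ (OepsZ d (Oeps_eps 2))))) => // x.
  by ring.
by apply/subr_cvg0; exact: Oeps_cvg0.
Qed.

(* [1 / (1 + h) = 1 - h + h ^ 2 / (1 + h)] *)
Lemma jet_inv u b : jet 2 u 1 b 0 -> jet 2 (fun x => (u x)^-1) 1 (- b) 0.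
Proof.
move=> ju; have u1 := jet_cvg (ltn0Sn 1) ju.
have vO : Oeps 0 (fun x => (u x)^-1).
  exists 2; near=> x; rewrite mulr1 normfV invf_ple ?posrE ?normr_gt0//.
  - suff : 2^-1 <= u x by move=> ux; rewrite ger0_norm// (le_trans _ ux)// invr_ge0.
    near: x; apply: (cvgr_ge _ u1); lra.
  - suff : 0 < u x by move=> /lt0r_neq0.
    near: x; apply: (cvgr_gt _ u1); lra.
have uN0 : \forall x \near c, u x != 0 by apply: (cvgr_neq0 _ u1); exact: oner_neq0.
have jh := jetM (isT : (2 <= 3)%N) ju (jet_poly 2 1 (- b) 0).
have h1 := OepsMb vO (jetB (jet_poly 2 1 0 0) jh).
have h2 := OepsMb (OepsMb vO (Oeps_cst (b ^+ 2))) (Oeps_eps 2).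
apply: Oeps_near (OepsD h1 h2); near=> x.
have ux0 : u x != 0 by near: x.
by field.
Unshelve. all: by end_near. Qed.

(* [sqrt u - s = (u - s ^ 2) / (sqrt u + s)], with [s = 1 + b eps / 2] *)
Lemma jet_sqrt u b : jet 2 u 1 b 0 ->
  jet 2 (fun x => Num.sqrt (u x)) 1 (b / 2) 0.
Proof.
move=> ju; have u1 := jet_cvg (ltn0Sn 1) ju.
pose s x := 1 + b / 2 * (x - c) + 0 * (x - c) ^+ 2.
have js : jet 2 s 1 (b / 2) 0 by exact: jet_poly.
have s1 := jet_cvg (ltn0Sn 1) js.
have sg : \forall x \near c, 2^-1 <= s x by apply: (cvgr_ge _ s1); lra.
have ug : \forall x \near c, 0 <= u x by apply: (cvgr_ge _ u1); lra.
have vO : Oeps 0 (fun x => (Num.sqrt (u x) + s x)^-1).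
  exists 2; near=> x; have sx : 2^-1 <= s x by near: x.
  have sux : 2^-1 <= Num.sqrt (u x) + s x by rewrite ler_wpDl// sqrtr_ge0.
  have sup : 0 < Num.sqrt (u x) + s x by apply: lt_le_trans sux; rewrite invr_gt0.
  by rewrite mulr1 gtr0_norm ?invr_gt0// invf_ple ?posrE.
have h1 := OepsMb vO (jetB ju (jetM (isT : (2 <= 3)%N) js js)).
have h2 := OepsMb (OepsMb vO (Oeps_cst (- (b ^+ 2 / 4)))) (Oeps_eps 2).
apply: Oeps_near (OepsD h1 h2); near=> x.
have sx : 2^-1 <= s x by near: x.
have ux : 0 <= u x by near: x.
have -> : 1 + b / 2 * (x - c) + 0 * (x - c) ^+ 2 = s x by [].
have sup : Num.sqrt (u x) + s x != 0.
  by rewrite gt_eqF// ltr_wpDl ?sqrtr_ge0// (lt_le_trans _ sx)// invr_gt0.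
rewrite -[X in _ * (X - _ - _)](sqr_sqrtr ux).
move: sup; set y := Num.sqrt _ => sup.
have e : s x = 1 + b / 2 * (x - c) by rewrite /s; ring.
rewrite e in sup *; field.
by move: sup; apply: contra => /eqP h; apply/eqP; nra.
Unshelve. all: by end_near. Qed.
End Asymptotics.

(** * From explicit bounds to Landau notation, real and complex *)

Section Landau.
Variables (R : realType).

Lemma bigO_real (F : filter_on R) (f g : R -> R) (K : R) :
  (\forall x \near F, `|f x| <= K * `|g x|) -> f =O_F g.
Proof.
move=> fg; apply/eqO_exP; exists (`|K| + 1); first by rewrite ltr_wpDl.
near=> x; apply: le_trans (near fg x _) _ => //.
by rewrite ler_wpM2r// (le_trans (ler_norm K))// lerDl.
Unshelve. all: by end_near. Qed.

Lemma normc_le (z : R[i]) : normc z <= `|complex.Re z| + `|complex.Im z|.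
Proof.
case: z => x y /=.
rewrite -[leRHS]ger0_norm ?addr_ge0// -sqrtr_sqr ler_wsqrtr// sqrrD.
by rewrite !real_normK ?num_real// lerD2r lerDl mulrn_wge0// mulr_ge0.
Qed.

Lemma bigO_complex (F : filter_on R) (f : R -> R[i]) (g : R -> R) (K L : R) :
  (\forall x \near F, `|complex.Re (f x)| <= K * `|g x|) ->
  (\forall x \near F, `|complex.Im (f x)| <= L * `|g x|) ->
  toC f =O_F toC (fun x => (g x)%:C).
Proof.
move=> fK fL; apply/eqO_exP; exists (`|K| + `|L| + 1)%:C.
  by rewrite ltcR ltr_wpDl// addr_ge0.
near=> x; suff : normc (f x) <= (`|K| + `|L| + 1) * `|g x|.
  have -> : `|toC (fun x => (g x)%:C) x| = (`|g x|)%:C.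
    by rewrite /toC [LHS]normc_def /= expr0n/= addr0 sqrtr_sqr.
  by rewrite -lecR rmorphM.
apply: le_trans (normc_le _) _; rewrite 2!mulrDl mul1r -[leLHS]addr0 lerD// lerD//.
- apply: le_trans (near fK x _) _ => //.
  by rewrite ler_wpM2r// ler_norm.
- apply: le_trans (near fL x _) _ => //.
  by rewrite ler_wpM2r// ler_norm.
Unshelve. all: by end_near. Qed.
End Landau.

(** * Derivatives within an interval *)

Section Derivatives.
Variables (R : realType).

(** A neighbourhood of an interior point lies in [J], so there the relative difference quotient is
    the ordinary one. *)
Lemma is_derive_on_entry (J : set R) (f f' : R -> 'M[R]_2) (x : R) i j :
  is_derive_on J f f' -> J^° x ->
  is_derive (x : R) (1 : R) (fun y => f y i j) (f' x i j).
Proof.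
move=> ff' Jx; apply/is_derive1_cvgP.
have Jx' : J x by exact: interior_subset Jx.
have h := cvg_comp _ _ (ff' x Jx') (@coord_continuous _ _ _ i j (f' x)).
have JxP : x^' --> within J x^'.
  move=> P JP; change (\forall y \near x, y != x -> P y).
  change (\forall y \near x, y != x -> J y -> P y) in JP.
  by move: Jx JP; apply: filterS2 => y Jy + yx => /(_ yx Jy).
have {}h : (fun y => ((y - x)^-1 *: (f y - f x)) i j) @ x^' --> f' x i j.
  exact: cvg_trans (cvg_app _ JxP) h.
apply: cvg_trans h; apply: near_eq_cvg; near=> y.
by rewrite !mxE.
Unshelve. all: by end_near. Qed.

(** Near [x] the entry's difference quotient is at most [|f' x i j| + 1] in absolute value, a
    Lipschitz bound at [x] that also covers an endpoint of [J]. *)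
Lemma is_derive_on_cvg (J : set R) (f f' : R -> 'M[R]_2) (x : R) i j :
  is_derive_on J f f' -> J x ->
  (fun y => f y i j) @ within J (nbhs x) --> f x i j.
Proof.
move=> ff' Jx.
have h := cvg_comp _ _ (ff' x Jx) (@coord_continuous _ _ _ i j (f' x)).
have FF : Filter (within J x^') := within_filter _ _.
have hb : \forall y \near x, y != x -> J y ->
    `|((y - x)^-1 *: (f y - f x)) i j - f' x i j| <= 1 :=
  cvgr_distC_le _ _ h _ ltr01.
have K0 : 0 < `|f' x i j| + 1 by rewrite ltr_wpDl.
apply/cvgrPdist_le => /= e e0.
have hd : \forall y \near x, `|y - x| < e / (`|f' x i j| + 1).
  by apply: near_dist_lt; rewrite divr_gt0.
change (\forall y \near x, J y -> `|f x i j - f y i j| <= e).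
near=> y; move=> Jy; rewrite distrC.
have [->|yx] := eqVneq y x; first by rewrite subrr normr0 ltW.
have : `|((y - x)^-1 *: (f y - f x)) i j - f' x i j| <= 1 by move: yx Jy; near: y; exact: hb.
move=> /(le_trans (lerB_dist _ _)).
rewrite lerBlDl !mxE normrM normfV ler_pdivrMl ?normr_gt0 ?subr_eq0//.
move=> /le_trans; apply; rewrite ?[1 + _]addrC.
have : `|y - x| < e / (`|f' x i j| + 1) by near: y.
by rewrite ltr_pdivlMr// => /ltW.
Unshelve. all: by end_near. Qed.

Lemma is_derive_on_within (J : set R) (f f' : R -> 'M[R]_2) (a b : R) i j :
  is_derive_on J f f' -> `[a, b]%classic `<=` J ->
  {within `[a, b], continuous (fun y => f y i j)}.
Proof.
move=> ff' abJ; apply: (@continuous_subspaceW _ _ _ J) => //.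
by apply/subspace_continuousP => x Jx; exact: is_derive_on_cvg ff' Jx.
Qed.

Lemma interval_interior (J : set R) (a b x : R) :
  is_interval J -> J a -> J b -> x \in `]a, b[ -> J^° x.
Proof.
move=> iJ Ja Jb xab.
have : `]a, b[%classic `<=` J.
  by move=> y /=; rewrite in_itv/= => /andP[ay yb]; apply: (iJ a b) => //; rewrite !ltW.
rewrite open_subsetE; first exact.
exact: interval_open.
Qed.

(** The product of [E] with [expR (K * x)] has nonnegative derivative, hence its value at [a] is at
    most its value at [b]. *)
Lemma gronwall_backward (E dE : R -> R) (K a b : R) : a <= b ->
  (forall x, x \in `]a, b[ -> is_derive (x : R) (1 : R) E (dE x)) ->
  {within `[a, b], continuous E} ->
  (forall x, x \in `]a, b[ -> - (K * E x) <= dE x) ->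
  E b <= 0 -> E a <= 0.
Proof.
move=> ab Ed Ec EK Eb.
pose g x := expR (K * x).
have gd x : is_derive (x : R) (1 : R) g (K * expR (K * x)).
  have h : is_derive (x : R) (1 : R) (expR \o (K \*: id)) (expR (K * x) * (K *: 1)).
    exact: is_derive1_comp.
  by apply: (is_derive_eq h); rewrite [_ *: _]mulr1 mulrC.
have Fd x : x \in `]a, b[ -> is_derive (x : R) (1 : R) (E * g) (g x * (dE x + K * E x)).
  move=> xab; have := Ed x xab => Edx.
  apply: is_derive_eq; rewrite /g /= /GRing.scale/=; ring.
have := @ger0_derive1_ndecr _ (E * g) a b _ _ _ a b (lexx _) ab (lexx _).
have gt0 x : 0 < g x by exact: expR_gt0.
move=> H; have : (E * g) a <= (E * g) b.
  apply: H => [x xab|x xab|].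
  - by have [] := Fd x xab.
  - have Fdx := Fd x xab; rewrite derive1E derive_val mulr_ge0 ?(ltW (gt0 _))//.
    by have := EK x xab; lra.
  - move=> x; apply: cvgM; first exact: Ec.
    apply: continuous_subspaceT => y.
    apply: differentiable_continuous; apply/derivable1_diffP.
    by have [] := gd y.
move=> Fab; have : E a * g a <= 0.
  by apply: le_trans Fab _; rewrite mulr_le0_ge0// ltW.
by rewrite pmulr_lle0.
Qed.
End Derivatives.

(** * Two-by-two matrices *)

Section Matrix2.
Variable R : fieldType.

Lemma ord2_ind (P : 'I_2 -> Prop) : P 0 -> P 1 -> forall i, P i.
Proof.
move=> P0 P1 [[|[|//]] hi].
- by rewrite (_ : Ordinal hi = 0)//; exact: val_inj.
- by rewrite (_ : Ordinal hi = 1)//; exact: val_inj.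
Qed.

Lemma mulmx2E (A B : 'M[R]_2) i j : (A *m B) i j = A i 0 * B 0 j + A i 1 * B 1 j.
Proof.
by rewrite mxE 2!big_ord_recl big_ord0 addr0; congr (_ + A i _ * B _ j); exact: val_inj.
Qed.

Lemma det2E (A : 'M[R]_2) : \det A = A 0 0 * A 1 1 - A 0 1 * A 1 0.
Proof.
rewrite (expand_det_row _ 0) !big_ord_recl big_ord0 /cofactor !det_mx11 !mxE /=.
transitivity (A 0 0 * ((-1) ^+ 0 * A 1 1) + (A 0 1 * ((-1) ^+ 1 * A 1 0) + 0)).
  by congr (A _ _ * (_ * A _ _) + (A _ _ * (_ * A _ _) + 0)); exact: val_inj.
by ring.
Qed.

(** Cramer's rule: after substituting [B = S *m A] it is an identity in the entries of [S] and
    [A]. *)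
Lemma mulmx_invmx2 (A B : 'M[R]_2) (i : 'I_2) : A \in unitmx ->
  (B *m invmx A) i 0 = (B i 0 * A 1 1 - B i 1 * A 1 0) / \det A /\
  (B *m invmx A) i 1 = (B i 1 * A 0 0 - B i 0 * A 0 1) / \det A.
Proof.
move=> Au; have detA : \det A != 0 by rewrite -unitfE -unitmxE.
set S := _ *m _; have SA : S *m A = B by rewrite mulmxKV.
rewrite -SA !mulmx2E.
by split; move: detA; rewrite det2E => detA; field.
Qed.

End Matrix2.

(** * The Jacobi equation *)

Section Ode.
Variables (R : realType) (J : set R) (T D D' : R -> 'M[R]_2).
Hypothesis itvJ : is_interval J.
Hypothesis symT : forall x, J x -> (T x)^T = T x.
Hypothesis derD : is_derive_on J D D'.
Hypothesis derD' : is_derive_on J D' (fun x => T x *m D x).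

Lemma is_derive_D i j x : J^° x -> is_derive (x : R) (1 : R) (fun y => D y i j) (D' x i j).
Proof. exact: is_derive_on_entry derD. Qed.

Lemma is_derive_D' i j x : J^° x -> is_derive (x : R) (1 : R) (fun y => D' y i j)
  (T x i 0 * D x 0 j + T x i 1 * D x 1 j).
Proof. by move=> /(is_derive_on_entry i j derD'); rewrite mulmx2E. Qed.

(** The (0,1) entry of [D^T D' - D'^T D]; that matrix is antisymmetric, so this entry determines
    it. *)
Definition wronskian x : R :=
  D x 0 0 * D' x 0 1 + D x 1 0 * D' x 1 1 - (D x 0 1 * D' x 0 0 + D x 1 1 * D' x 1 0).

(** The terms quadratic in [D'] cancel, and what remains of the derivative is an entry of
    [D^T (T - T^T) D], which is zero. *)
Lemma wronskian_cst a b : J a -> J b -> a <= b -> wronskian a = wronskian b.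
Proof.
move=> Ja Jb; rewrite le_eqVlt => /predU1P[->//|ab].
have abJ : `[a, b]%classic `<=` J.
  by move=> x /=; rewrite in_itv/=; exact: itvJ.
have Wd x : x \in `]a, b[ -> is_derive (x : R) (1 : R) wronskian 0.
  move=> xab; have Jx := interval_interior itvJ Ja Jb xab.
  have T10 : T x 1 0 = T x 0 1.
    by rewrite -[in LHS](symT (interior_subset Jx)) mxE.
  have d i j := is_derive_D i j Jx.
  have d' i j := is_derive_D' i j Jx.
  have h1 := is_deriveD (is_deriveM (d 0 0) (d' 0 1)) (is_deriveM (d 1 0) (d' 1 1)).
  have h2 := is_deriveD (is_deriveM (d 0 1) (d' 0 0)) (is_deriveM (d 1 1) (d' 1 0)).
  apply: (is_derive_eq (is_deriveB h1 h2)); rewrite T10 /GRing.scale/=; ring.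
have Wc : {within `[a, b], continuous wronskian}.
  have c i j := is_derive_on_within (i := i) (j := j) derD abJ.
  have c' i j := is_derive_on_within (i := i) (j := j) derD' abJ.
  move=> x; apply: cvgB; apply: cvgD; apply: cvgM; try exact: c; exact: c'.
have [y yab] := MVT ab Wd Wc.
by rewrite mul0r => /eqP; rewrite subr_eq0 => /eqP.
Qed.

Hypothesis J0 : J 0.
Hypothesis J_ge0 : forall x, J x -> 0 <= x.
Hypothesis D0 : D 0 = 0.

Lemma wronskian0 x : J x -> wronskian x = 0.
Proof.
move=> Jx; rewrite -(wronskian_cst J0 Jx (J_ge0 Jx)) /wronskian D0 !mxE.
by ring.
Qed.

(** Compactness bounds each entry separately; the sum of the four bounds serves for all of them. *)
Lemma bounded_T k b : C_on k.+1 J T -> `[0, b]%classic `<=` J ->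
  exists B, forall x i j, x \in `[0, b] -> `|T x i j| <= B.
Proof.
move=> [T' dT _] bJ.
have Tij (ij : 'I_2 * 'I_2) : exists B,
    forall x, x \in `[0, b] -> `|T x ij.1 ij.2| <= B.
  have := continuous_compact
    (is_derive_on_within (i := ij.1) (j := ij.2) dT bJ) (@segment_compact _ 0 b).
  move=> /compact_bounded[M [_ MP]]; exists (M + 1) => x xb.
  by apply: (MP (M + 1)); [rewrite ltrDl|exists x].
have [B TB] := choice Tij; exists (\sum_ij `|B ij|) => x i j xb.
apply: le_trans (TB (i, j) x xb) _.
by rewrite (bigD1 (i, j))//= ler_wpDr ?sumr_ge0 ?ler_norm.
Qed.

(* The squared norm [E] of [(D v, D' v)] satisfies [E' >= - K E], so it cannot
   vanish at [x] unless it vanishes at [0]. *)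
Lemma ode_kernel k x (v0 v1 : R) : C_on k.+1 J T -> J x ->
  (forall i, D x i 0 * v0 + D x i 1 * v1 = 0) ->
  (forall i, D' x i 0 * v0 + D' x i 1 * v1 = 0) ->
  forall i, D' 0 i 0 * v0 + D' 0 i 1 * v1 = 0.
Proof.
move=> CT Jx Dv Dv'.
have xJ : `[0, x]%classic `<=` J.
  by move=> y /=; rewrite in_itv/=; exact: itvJ.
have [B TB] := bounded_T CT xJ.
pose u i y := D y i 0 * v0 + D y i 1 * v1.
pose w i y := D' y i 0 * v0 + D' y i 1 * v1.
pose E y := u 0 y * u 0 y + u 1 y * u 1 y + (w 0 y * w 0 y + w 1 y * w 1 y).
pose dw i y := T y i 0 * u 0 y + T y i 1 * u 1 y.
pose dE y := 2 * (u 0 y * w 0 y + u 1 y * w 1 y + (w 0 y * dw 0 y + w 1 y * dw 1 y)).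
have cst_d (v : R) (y : R) : is_derive (y : R) (1 : R) (fun=> v) 0 by exact: is_derive_cst.
have ud i y : y \in `]0, x[ -> is_derive (y : R) (1 : R) (u i) (w i y).
  move=> /(interval_interior itvJ J0 Jx) Jy.
  have h j v := is_deriveM (is_derive_D i j Jy) (cst_d v y).
  by apply: (is_derive_eq (is_deriveD (h 0 v0) (h 1 v1))); rewrite /w /GRing.scale/=; ring.
have wd i y : y \in `]0, x[ -> is_derive (y : R) (1 : R) (w i) (dw i y).
  move=> /(interval_interior itvJ J0 Jx) Jy.
  have h j v := is_deriveM (is_derive_D' i j Jy) (cst_d v y).
  by apply: (is_derive_eq (is_deriveD (h 0 v0) (h 1 v1))); rewrite /dw /u /GRing.scale/=; ring.
have Ed y : y \in `]0, x[ -> is_derive (y : R) (1 : R) E (dE y).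
  move=> yx; have uu i := is_deriveM (ud i y yx) (ud i y yx).
  have ww i := is_deriveM (wd i y yx) (wd i y yx).
  apply: (is_derive_eq (is_deriveD (is_deriveD (uu 0) (uu 1)) (is_deriveD (ww 0) (ww 1)))).
  by rewrite /dE /GRing.scale/=; ring.
have uc i : {within `[0, x], continuous (u i)}.
  have c j := is_derive_on_within (i := i) (j := j) derD xJ.
  by move=> y; apply: cvgD; (apply: cvgM; [exact: c|exact: cvg_cst]).
have wc i : {within `[0, x], continuous (w i)}.
  have c j := is_derive_on_within (i := i) (j := j) derD' xJ.
  by move=> y; apply: cvgD; (apply: cvgM; [exact: c|exact: cvg_cst]).
have Ec : {within `[0, x], continuous E}.
  by move=> y; apply: cvgD; apply: cvgD; apply: cvgM; try exact: uc; exact: wc.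
have : E 0 <= 0.
  (* The products [u i * w i] cost 1; each [u i] and each [w i] occurs in two of the four products
     with an entry of [T], which costs [2 * B]. *)
  apply: (gronwall_backward (J_ge0 Jx) Ed Ec (K := 1 + 2 * B)).
  - move=> y yx; rewrite /dE /E /dw.
    (* Expand [(B + t) (p + r)^2 + (B - t) (p - r)^2 >= 0]. *)
    have young (t p r : R) : `|t| <= B -> - (B * (p * p + r * r)) <= 2 * (p * (t * r)).
      rewrite ler_norml -subr_ge0 opprK -[t <= B]subr_ge0 => /andP[tB Bt].
      have := mulr_ge0 tB (sqr_ge0 (p + r)); have := mulr_ge0 Bt (sqr_ge0 (p - r)).
      lra.
    have b i j : `|T y i j| <= B by exact/TB/subset_itv_oo_cc.
    have h00 := young _ (w 0 y) (u 0 y) (b 0 0).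
    have h01 := young _ (w 0 y) (u 1 y) (b 0 1).
    have h10 := young _ (w 1 y) (u 0 y) (b 1 0).
    have h11 := young _ (w 1 y) (u 1 y) (b 1 1).
    have s0 := sqr_ge0 (u 0 y + w 0 y); have s1 := sqr_ge0 (u 1 y + w 1 y).
    lra.
  - by rewrite /E /u /w !Dv !Dv'; lra.
rewrite /E => E0.
by apply: ord2_ind; rewrite -/(w _ 0); nra.
Qed.
End Ode.

(** * Integrating and dividing expansions; the signed square root near a simple zero *)

Section Jets.
Variables (R : realType) (c : R).
Implicit Types (f g : R -> R) (n : nat).

(** Subtracting the integrated polynomial leaves a function that vanishes at [c] and whose
    derivative is the error of [g]. *)
Lemma jet_primitive n f g b d :
  (\forall x \near c, is_derive (x : R) (1 : R) f (g x)) ->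
  jet c n g b d 0 -> jet c n.+1 f (f c) b (d / 2).
Proof.
move=> fg jg.
pose P x := f c + b * (x - c) + d / 2 * (x - c) ^+ 2.
apply: (@Oeps_primitive _ _ _ (f \- P) (fun x => g x - (b + d * (x - c) + 0 * (x - c) ^+ 2))).
- near=> x; have fx : is_derive (x : R) (1 : R) f (g x) by near: x.
  have Px : is_derive (x : R) (1 : R) P (b + d * (x - c)).
    apply: is_derive_eq; rewrite /GRing.scale/=; by field.
  by apply: is_derive_eq; ring.
- by rewrite /P /=; ring.
- exact: jg.
Unshelve. all: by end_near. Qed.

Lemma Oeps_divr n f : Oeps c n.+1 f -> Oeps c n (fun x => f x / (x - c)).
Proof.
move=> /Oeps_ge0[K K0 fK]; exists K; near=> x.
(* At [c] the quotient is 0, because [0^-1 = 0]. *)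
have [->|xc] := eqVneq x c.
  by rewrite subrr invr0 mulr0 normr0 mulr_ge0// exprn_ge0.
rewrite normrM normfV ler_pdivrMr ?normr_gt0 ?subr_eq0// -mulrA -exprSr.
by near: x.
Unshelve. all: by end_near. Qed.

(** The bare quotient takes the value 0 at [c]; setting it to [b] there keeps the expansion valid on
    a full neighbourhood. *)
Lemma jet_slope n f b d : jet c n.+1 f 0 b d ->
  jet c n (fun x => if x == c then b else f x / (x - c)) b d 0.
Proof.
move=> /Oeps_divr; apply: Oeps_ext => x.
have [->|xc] := eqVneq x c; first by rewrite subrr invr0; ring.
by field; rewrite subr_eq0.
Qed.

Lemma jet_cvg_slope n f b d : jet c n.+2 f 0 b d ->
  (fun x => f x / (x - c)) @ c^' --> b.
Proof.
move=> /jet_slope/(jet_cvg (ltn0Sn n)) /(cvg_trans (cvg_app _ (@nbhs_dnbhs _ c))).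
apply: cvg_trans; apply: near_eq_cvg; near=> x.
have xc : x != c by near: x; exact: nbhs_dnbhs_neq.
by rewrite (negbTE xc).
Unshelve. all: by end_near. Qed.

Lemma jet_is_derive n f b d : jet c n.+2 f 0 b d -> f c = 0 ->
  is_derive (c : R) (1 : R) f b.
Proof.
move=> jf fc0; apply/is_derive1_cvgP; apply: cvg_trans (jet_cvg_slope jf).
by apply: near_eq_cvg; near=> x; rewrite fc0 subr0 mulrC.
Unshelve. all: by end_near. Qed.

Lemma Oeps_bigO n f : Oeps c n f -> f =O_ (nbhs c) (fun x => (x - c) ^+ n).
Proof.
move=> [K fK]; apply: (@bigO_real _ _ _ _ K); near=> x.
by rewrite normrX; near: x.
Unshelve. all: by end_near. Qed.

(** For quantities known by a formula only off [c]. The bound stays explicit so that it can feed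
    [bigO_real] or one part of [bigO_complex]. *)
Lemma Oeps_dnbhs n f g :
  (\forall x \near c, x != c -> f x = g x) -> Oeps c n g ->
  exists K : R, \forall x \near c^', `|f x| <= K * `|(x - c) ^+ n|.
Proof.
move=> fg [K gK]; exists K; rewrite near_withinE; near=> x; move=> xc.
have -> : f x = g x by move: xc; near: x.
by rewrite normrX; near: x.
Unshelve. all: by end_near. Qed.

Lemma Oeps_bigO_complex n (f : R -> R[i]) :
  Oeps c n (fun x => complex.Re (f x)) -> Oeps c n (fun x => complex.Im (f x)) ->
  toC f =O_ (nbhs c) toC (fun x => ((x - c) ^+ n)%:C).
Proof.
move=> [K fK] [L fL]; apply: (@bigO_complex _ _ _ _ K L); near=> x.
- by rewrite normrX; near: x.
- by rewrite normrX; near: x.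
Unshelve. all: by end_near. Qed.

Lemma signed_sqrt_gt0 (d : R) : (0 < signed_sqrt d) = (0 < d).
Proof.
rewrite /signed_sqrt; case: (ltgtP 0 d) => [d0|d0|<-].
- by rewrite gtr0_sg// mul1r sqrtr_gt0 normr_gt0 gt_eqF.
- by rewrite ltr0_sg// mulN1r oppr_gt0 ltNge sqrtr_ge0.
- by rewrite sgr0 mul0r ltxx.
Qed.

Lemma signed_sqrtN (d : R) : signed_sqrt (- d) = - signed_sqrt d.
Proof. by rewrite /signed_sqrt sgrN normrN mulNr. Qed.

Lemma signed_sqrt_lt0 (d : R) : (signed_sqrt d < 0) = (d < 0).
Proof. by rewrite -oppr_gt0 -signed_sqrtN signed_sqrt_gt0 oppr_gt0. Qed.

Lemma signed_sqrtM (a u : R) : 0 < u ->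
  signed_sqrt (a * u) = signed_sqrt a * Num.sqrt u.
Proof.
move=> u0; rewrite /signed_sqrt sgrM (gtr0_sg u0) mulr1 normrM (gtr0_norm u0).
by rewrite sqrtrM// mulrA.
Qed.

Lemma norm_signed_sqrt (d : R) : `|signed_sqrt d| = Num.sqrt `|d|.
Proof.
rewrite /signed_sqrt normrM normr_sg (ger0_norm (sqrtr_ge0 _)).
by have [->|] := eqVneq d 0; rewrite ?normr0 ?sqrtr0 ?mulr0 ?mul1r.
Qed.

(** The modulus is [Num.sqrt] of the modulus of [f x], so the jump of the sign is harmless at a
    zero. *)
Lemma signed_sqrt_continuous f : f c = 0 -> {for c, continuous f} ->
  {for c, continuous (fun x => signed_sqrt (f x))}.
Proof.
move=> fc0 cf; rewrite /prop_for /continuous_at fc0 {2}/signed_sqrt sgr0 mul0r.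
apply: norm_cvg0.
have -> : (fun x => `|signed_sqrt (f x)|) = (fun x => Num.sqrt `|f x|).
  by apply/funext => x; exact: norm_signed_sqrt.
have : (fun x => Num.sqrt `|f x|) @ c --> Num.sqrt `|f c|.
  by apply: (@cvg_comp _ _ _ (fun x => `|f x|) (@Num.sqrt R) _ (nbhs `|f c|));
    [exact: cvg_norm|exact: sqrt_continuous].
by rewrite fc0 normr0 sqrtr0.
Qed.

Lemma jet_pos_factor f b d : 0 < b -> jet c 3 f 0 b d ->
  \forall x \near c, x != c -> 0 < f x / (x - c).
Proof.
move=> b0 jf.
have : \forall x \near c^', 0 < f x / (x - c).
  exact: (cvgr_gt _ (jet_cvg_slope jf)).
by rewrite near_withinE.
Qed.

Lemma signed_sqrt_cross f b d : 0 < b -> jet c 3 f 0 b d ->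
  (\forall x \near c^'-, signed_sqrt (f x) < 0) /\
  (\forall x \near c^'+, 0 < signed_sqrt (f x)).
Proof.
move=> b0 /(jet_pos_factor b0) fb; split; rewrite near_withinE; apply: filterS fb => x + xc.
- rewrite lt_eqF// => /(_ isT).
  by rewrite signed_sqrt_lt0 nmulr_lgt0// invr_lt0 subr_lt0.
- rewrite gt_eqF// => /(_ isT).
  by rewrite signed_sqrt_gt0 pmulr_lgt0// invr_gt0 subr_gt0.
Qed.

Lemma signed_sqrt_div_gt0 (a b : R) : 0 < a / b -> 0 < signed_sqrt a / b.
Proof.
case: (ltgtP b 0) => [b0|b0|->]; last by rewrite invr0 mulr0 ltxx.
- by rewrite (nmulr_lgt0 a) ?invr_lt0// (nmulr_lgt0 (signed_sqrt a)) ?invr_lt0// signed_sqrt_lt0.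
- by rewrite (pmulr_lgt0 a) ?invr_gt0// (pmulr_lgt0 (signed_sqrt a)) ?invr_gt0// signed_sqrt_gt0.
Qed.

(** Near [c] the modulus of [f x] exceeds [b / 2] times the distance to [c], so the slope grows at
    least like the inverse square root of that distance. *)
Lemma signed_sqrt_slope f b d : 0 < b -> f c = 0 -> jet c 3 f 0 b d ->
  (fun x => (signed_sqrt (f x) - signed_sqrt (f c)) / (x - c)) @ c^' --> +oo.
Proof.
move=> b0 fc0 jf; rewrite fc0 {2}/signed_sqrt sgr0 mul0r.
apply/cvgryPge => A; pose B := `|A| + 1; have B0 : 0 < B by rewrite ltr_wpDl.
have fb : \forall x \near c, x != c -> b / 2 < f x / (x - c).
  have : \forall x \near c^', b / 2 < f x / (x - c).
    by apply: (cvgr_gt _ (jet_cvg_slope jf)); rewrite ltr_pdivrMr// ltr_pMr// ltr1n.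
  by rewrite near_withinE.
rewrite near_withinE; near=> x; move=> xc.
(* This radius gives [B^2 |x - c| < b / 2 < |f x| / |x - c|], that is [(B |x - c|)^2 <= |f x|]. *)
have xB : `|x - c| < b / 2 / B ^+ 2.
  by near: x; apply: near_dist_lt; rewrite !divr_gt0// exprn_gt0.
have fxb : b / 2 < f x / (x - c) by move: xc; near: x.
have fpos : 0 < f x / (x - c) by apply: lt_trans fxb; rewrite divr_gt0.
have xc0 : 0 < `|x - c| by rewrite normr_gt0 subr_eq0.
have ->// : (signed_sqrt (f x) - 0) / (x - c) = Num.sqrt `|f x| / `|x - c|.
  by rewrite subr0 -norm_signed_sqrt -normfV -normrM gtr0_norm ?signed_sqrt_div_gt0.
rewrite ler_pdivlMr//; apply: (@le_trans _ _ (B * `|x - c|)).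
  by rewrite ler_wpM2r// (le_trans (ler_norm A))// lerDl.
rewrite -[leLHS]ger0_norm ?mulr_ge0 ?(ltW B0)// -sqrtr_sqr ler_wsqrtr//.
rewrite exprMn expr2 -[X in X <= _]mulrA expr2 mulrA.
rewrite mulrA -ler_pdivlMr// -normfV -normrM (gtr0_norm fpos).
move: xB; rewrite ltr_pdivlMr ?exprn_gt0// mulrC => /ltW/le_trans; apply.
exact: ltW.
Unshelve. all: by end_near. Qed.
End Jets.

(** * Real and imaginary parts of complex limits and derivatives *)

Section Complex.
Variable R : realType.

Lemma normc_sqr (z : R[i]) : normc z ^+ 2 = complex.Re z ^+ 2 + complex.Im z ^+ 2.
Proof. by case: z => x y /=; rewrite sqr_sqrtr// addr_ge0 ?sqr_ge0. Qed.

Lemma normc_ge0 (z : R[i]) : 0 <= normc z.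
Proof. by case: z => x y; exact: sqrtr_ge0. Qed.

Lemma norm_Re_le (z : R[i]) : `|complex.Re z| <= normc z.
Proof.
rewrite -ler_sqr ?nnegrE ?normc_ge0// normc_sqr real_normK ?num_real//.
by rewrite lerDl sqr_ge0.
Qed.

Lemma norm_Im_le (z : R[i]) : `|complex.Im z| <= normc z.
Proof.
rewrite -ler_sqr ?nnegrE ?normc_ge0// normc_sqr real_normK ?num_real//.
by rewrite lerDr sqr_ge0.
Qed.

Lemma toC_cvg (F : set_system R) (f : R -> R[i]) (l : R[i]) : Filter F ->
  toC f @ F --> (l : R[i]^o) ->
  (fun x => complex.Re (f x)) @ F --> complex.Re l /\
  (fun x => complex.Im (f x)) @ F --> complex.Im l.
Proof.
move=> FF fl.
have near_le e : 0 < e -> \forall x \near F, normc (l - f x) <= e.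
  move=> e0; have e0C : 0 < e%:C :> R[i] by rewrite ltcR.
  move/cvgrPdist_le: fl => /(_ _ e0C).
  by apply: (@filterS _ F FF) => x; rewrite -lecR.
split; apply/cvgrPdist_le => /= e /near_le; apply: (@filterS _ F FF) => x; apply: le_trans.
- by apply: le_trans (norm_Re_le _); case: (l) => ? ?; case: (f x).
- by apply: le_trans (norm_Im_le _); case: (l) => ? ?; case: (f x).
Qed.

Lemma is_cderive_parts (f : R -> R[i]) (c : R) (l : R[i]) : is_cderive f c l ->
  is_derive (c : R) (1 : R) (fun x => complex.Re (f x)) (complex.Re l) /\
  is_derive (c : R) (1 : R) (fun x => complex.Im (f x)) (complex.Im l).
Proof.
move=> /toC_cvg[fr fi]; split; apply/is_derive1_cvgP.
- apply: cvg_trans fr; apply: near_eq_cvg; near=> x.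
  by rewrite /=; case: (f x) => ? ?; case: (f c) => ? ? /=; ring.
- apply: cvg_trans fi; apply: near_eq_cvg; near=> x.
  by rewrite /=; case: (f x) => ? ?; case: (f c) => ? ? /=; ring.
Unshelve. all: by end_near. Qed.
End Complex.

(** * Expansions at a conjugate point *)

Section Conjugate.
Variables (R : realType) (J : set R) (T D D' : R -> 'M[R]_2) (lc : R) (k : nat).
Hypothesis itvJ : is_interval J.
Hypothesis J0 : J 0.
Hypothesis J_ge0 : forall x, J x -> 0 <= x.
Hypothesis symT : forall x, J x -> (T x)^T = T x.
Hypothesis CT : C_on k.+1 J T.
Hypothesis derD : is_derive_on J D D'.
Hypothesis derD' : is_derive_on J D' (fun x => T x *m D x).
Hypothesis D0 : D 0 = 0.
Hypothesis D'0 : D' 0 = 1%:M.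
Hypothesis Jlc : J^° lc.
Hypothesis D10 : D lc 1 0 = 0.
Hypothesis D11 : D lc 1 1 = 0.
Hypothesis Dlc_neq0 : (D lc 0 0, D lc 0 1) != (0, 0).

Let JJlc : J lc := interior_subset Jlc.

Lemma near_interior : \forall x \near lc, J^° x.
Proof. exact: nbhs_interior. Qed.

Lemma T10E x : J x -> T x 1 0 = T x 0 1.
Proof. by move=> Jx; rewrite -[in LHS](symT Jx) mxE. Qed.

(** With the second row of [D lc] zero, only two terms of the vanishing Wronskian survive. *)
Lemma wronskian_lc : D lc 0 0 * D' lc 0 1 = D lc 0 1 * D' lc 0 0.
Proof.
have := wronskian0 itvJ symT derD derD' J0 J_ge0 D0 JJlc.
by rewrite /wronskian D10 D11 => /eqP; rewrite subr_eq0 => /eqP; lra.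
Qed.

(** [detD1] and [detD2] are the coefficients Q and P of [\det D] at [lc]. *)
Definition detD1 : R := D lc 0 0 * D' lc 1 1 - D lc 0 1 * D' lc 1 0.
Definition detD2 : R := D' lc 0 0 * D' lc 1 1 - D' lc 0 1 * D' lc 1 0.

(* Otherwise [D v] and [D' v] both vanish at [lc] for [v = (- D 0 1, D 0 0)]. *)
Lemma detD1_neq0 : detD1 != 0.
Proof.
apply: contra Dlc_neq0 => /eqP Q0.
have h := @ode_kernel _ _ _ _ _ itvJ derD derD' J0 J_ge0 k lc (- D lc 0 1) (D lc 0 0) CT JJlc.
have W := wronskian_lc.
(* Row 0 of [D' v] vanishes at [lc] by the Wronskian identity, row 1 because [detD1 = 0]. *)
have K : forall i, D' 0 i 0 * - D lc 0 1 + D' 0 i 1 * D lc 0 0 = 0.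
  apply: h; apply: ord2_ind; rewrite ?D10 ?D11; move: Q0; rewrite /detD1; lra.
by have := K 0; have := K 1; rewrite D'0 !mxE/= !mul1r !mul0r add0r addr0
  => -> /eqP; rewrite oppr_eq0 => /eqP->.
Qed.

Lemma jet1_of_derive (f : R -> R) (l : R) : is_derive (lc : R) (1 : R) f l ->
  jet lc 1 f (f lc) 0 0.
Proof. by move=> /Oeps_derive; apply: Oeps_ext => x; ring. Qed.

(** One derivative of [T] gives this first-order error; integrating [D'' = T D] twice then raises it
    to order three for [D]. *)
Lemma jetT i j : jet lc 1 (fun x => T x i j) (T lc i j) 0 0.
Proof.
have [T' dT _] := CT.
exact: (jet1_of_derive (is_derive_on_entry i j dT Jlc)).
Qed.

Definition D2 i j : R := T lc i 0 * D lc 0 j + T lc i 1 * D lc 1 j.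

Lemma jetD'_entry i j : jet lc 2 (fun x => D' x i j) (D' lc i j) (D2 i j) 0.
Proof.
have jD l m : jet lc 1 (fun x => D x l m) (D lc l m) 0 0.
  exact: (jet1_of_derive (is_derive_on_entry l m derD Jlc)).
have jTD := jetD (jetM (isT : (1 <= 3)%N) (jetT i 0) (jD 0 j))
                 (jetM (isT : (1 <= 3)%N) (jetT i 1) (jD 1 j)).
have {}jTD : jet lc 1 (fun x => T x i 0 * D x 0 j + T x i 1 * D x 1 j) (D2 i j) 0 0.
  by apply: (jet_eq jTD); rewrite /D2; ring.
have der : \forall x \near lc, is_derive (x : R) (1 : R) (fun y => D' y i j)
    (T x i 0 * D x 0 j + T x i 1 * D x 1 j).
  near=> x; apply: (is_derive_D' derD'); near: x; exact: near_interior.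
exact: (jet_quad _ (isT : (2 <= 2)%N) (jet_primitive der jTD)).
Unshelve. all: by end_near. Qed.

Lemma jetD_entry i j : jet lc 3 (fun x => D x i j) (D lc i j) (D' lc i j) (D2 i j / 2).
Proof.
have der : \forall x \near lc, is_derive (x : R) (1 : R) (fun y => D y i j) (D' x i j).
  near=> x; apply: (is_derive_D derD); near: x; exact: near_interior.
exact: (jet_primitive der (jetD'_entry i j)).
Unshelve. all: by end_near. Qed.

(** At [lc] the second row of [T D] is a multiple of the first row of [D], so second derivatives
    cancel from the quadratic coefficient. *)
Lemma jet_detD : jet lc 3 (fun x => \det (D x)) 0 detD1 detD2.
Proof.
have j := jetB (jetM (isT : (3 <= 3)%N) (jetD_entry 0 0) (jetD_entry 1 1))
               (jetM (isT : (3 <= 3)%N) (jetD_entry 0 1) (jetD_entry 1 0)).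
apply: (jet_near (f := fun x => D x 0 0 * D x 1 1 - D x 0 1 * D x 1 0)).
  by near=> x; rewrite det2E.
apply: (jet_eq j); rewrite /D2 /detD1 /detD2 ?D10 ?D11 ?(T10E JJlc); by field.
Unshelve. all: by end_near. Qed.

(** The Cramer numerators of three entries of [D' D^-1]; the fourth entry follows by symmetry. *)
Definition num00 x : R := D' x 0 0 * D x 1 1 - D' x 0 1 * D x 1 0.
Definition num11 x : R := D' x 1 1 * D x 0 0 - D' x 1 0 * D x 0 1.
Definition num01 x : R := D' x 0 1 * D x 0 0 - D' x 0 0 * D x 0 1.

Lemma jet_num00 : jet lc 2 num00 0 detD2 0.
Proof.
have jD i j := jet_le (isT : (2 <= 3)%N) (jetD_entry i j).
have j := jetB (jetM (isT : (2 <= 3)%N) (jetD'_entry 0 0) (jD 1 1))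
               (jetM (isT : (2 <= 3)%N) (jetD'_entry 0 1) (jD 1 0)).
by apply: (jet_eq1 _ (isT : (2 <= 2)%N) j); rewrite /D2 /detD2 ?D10 ?D11; ring.
Qed.

Lemma jet_num11 : jet lc 2 num11 detD1 detD2 0.
Proof.
have jD i j := jet_le (isT : (2 <= 3)%N) (jetD_entry i j).
have j := jetB (jetM (isT : (2 <= 3)%N) (jetD'_entry 1 1) (jD 0 0))
               (jetM (isT : (2 <= 3)%N) (jetD'_entry 1 0) (jD 0 1)).
by apply: (jet_eq1 _ (isT : (2 <= 2)%N) j); rewrite /D2 /detD1 /detD2 ?D10 ?D11; ring.
Qed.

(* The derivative of [num01] is [T 0 1 * \det D]. *)
Lemma jet_num01 : jet lc 3 num01 0 0 (T lc 0 1 * detD1 / 2).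
Proof.
have num0 : num01 lc = 0 by have := wronskian_lc; rewrite /num01; lra.
rewrite -[X in jet _ _ _ X]num0.
apply: (@jet_primitive _ _ _ _ (fun x => T x 0 1 * \det (D x))).
  near=> x; have Jx : J^° x by near: x; exact: near_interior.
  have d i j := is_derive_D derD i j Jx.
  have d' i j := is_derive_D' derD' i j Jx.
  have := is_deriveB (is_deriveM (d' 0 1) (d 0 0)) (is_deriveM (d' 0 0) (d 0 1)).
  by move=> h; apply: (is_derive_eq h); rewrite det2E /GRing.scale/=; ring.
have jd := jet_le (isT : (2 <= 3)%N) jet_detD.
have T1 : Oeps lc 1 (fun x => T x 0 1 - T lc 0 1).
  by apply: Oeps_ext (jetT 0 1) => x; ring.
have d1 : Oeps lc 1 (fun x => \det (D x)).
  apply: Oeps_ext (OepsD (jet_le (isT : (1 <= 2)%N) jd)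
    (OepsMb (jet0O (jet_poly lc 0 detD1 detD2 0)) (Oeps_eps lc 1))) => x.
  by ring.
apply: (jet_quad _ (isT : (2 <= 2)%N) (d := T lc 0 1 * detD2)).
apply: Oeps_ext (OepsD (OepsM T1 d1) (jetZ (T lc 0 1) jd)) => x.
by ring.
Unshelve. all: by end_near. Qed.

Definition kap : R := detD2 / detD1.
(* The factor [u] in [\det D = detD1 * eps * u], continued by [1] at [lc]. *)
Definition udet (x : R) : R :=
  detD1^-1 * (if x == lc then detD1 else \det (D x) / (x - lc)).

Lemma detD_lc : \det (D lc) = 0.
Proof. by rewrite det2E D10 D11; ring. Qed.

Lemma detD_udet x : \det (D x) = detD1 * (x - lc) * udet x.
Proof.
rewrite /udet; have Q0 := detD1_neq0.
have [->|xc] := eqVneq x lc; first by rewrite detD_lc; ring.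
by field; rewrite subr_eq0 xc Q0.
Qed.

Lemma jet_udet : jet lc 2 udet 1 kap 0.
Proof.
have Q0 := detD1_neq0.
by apply: (jet_eq (jetZ detD1^-1 (jet_slope jet_detD))); rewrite /kap; field.
Qed.

Lemma udet_gt0 : \forall x \near lc, 0 < udet x.
Proof. exact: (cvgr_gt _ (jet_cvg (ltn0Sn 1) jet_udet) _ ltr01). Qed.

Lemma D_unit : \forall x \near lc, x != lc -> D x \in unitmx.
Proof.
near=> x; move=> xc; have u0 : udet x != 0.
  by rewrite gt_eqF//; near: x; exact: udet_gt0.
rewrite unitmxE unitfE detD_udet; apply: mulf_neq0 => //.
by apply: mulf_neq0; [exact: detD1_neq0|rewrite subr_eq0].
Unshelve. all: by end_near. Qed.

Definition deformation x : 'M[R]_2 := D' x *m invmx (D x).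

Lemma deformation_entries x : D x \in unitmx ->
  [/\ deformation x 0 0 = num00 x / \det (D x), deformation x 0 1 = num01 x / \det (D x) &
      deformation x 1 1 = num11 x / \det (D x)].
Proof.
move=> Du; have [h00 h01] := mulmx_invmx2 (D' x) 0 Du.
by have [_ h11] := mulmx_invmx2 (D' x) 1 Du.
Qed.

(** The Cramer numerators of the two off-diagonal entries differ by the Wronskian. *)
Lemma deformation_sym x : J x -> D x \in unitmx -> (deformation x)^T = deformation x.
Proof.
move=> Jx Du; have W := wronskian0 itvJ symT derD derD' J0 J_ge0 D0 Jx.
have S01 : deformation x 1 0 = deformation x 0 1.
  have [_ h01] := mulmx_invmx2 (D' x) 0 Du.
  have [h10 _] := mulmx_invmx2 (D' x) 1 Du.
  rewrite /deformation h01 h10; congr (_ / _).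
  by move: W; rewrite /wronskian; lra.
by apply/matrixP; apply: ord2_ind; apply: ord2_ind; rewrite mxE.
Qed.

(** The numerator over Q is [1 + 2 kap eps], and dividing by [udet = 1 + kap eps] leaves one
    [kap]. *)
Lemma jet_theta :
  jet lc 2 (fun x => detD1^-1 * (num00 x + num11 x) * (udet x)^-1) 1 kap 0.
Proof.
have Q0 := detD1_neq0.
have j := jetM (isT : (2 <= 3)%N) (jetZ detD1^-1 (jetD jet_num00 jet_num11))
  (jet_inv jet_udet).
by apply: (jet_eq1 _ (isT : (2 <= 2)%N) j); rewrite /kap; field.
Qed.

(** The linear terms of the two numerators cancel, so only the [- kap] of the inverse of [udet]
    remains. *)
Lemma jet_sigma :
  jet lc 2 (fun x => detD1^-1 * (num11 x - num00 x) * (udet x)^-1) 1 (- kap) 0.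
Proof.
have Q0 := detD1_neq0.
have j := jetM (isT : (2 <= 3)%N) (jetZ detD1^-1 (jetB jet_num11 jet_num00))
  (jet_inv jet_udet).
by apply: (jet_eq1 _ (isT : (2 <= 2)%N) j); rewrite /kap; field.
Qed.

(** [num01] is already of second order, so replacing the inverse of [udet] by 1 costs only third
    order. *)
Lemma Oeps_num01 : Oeps lc 3 (fun x => detD1^-1 * num01 x * (udet x)^-1
  - T lc 0 1 / 2 * (x - lc) ^+ 2).
Proof.
have Q0 := detD1_neq0; have jv := jet_inv jet_udet.
have v1 : Oeps lc 1 (fun x => (udet x)^-1 - 1).
  apply: Oeps_ext (OepsD (jet_le (isT : (1 <= 2)%N) jv) (OepsZ (- kap) (Oeps_eps lc 1))) => x.
  by ring.
apply: Oeps_ext (OepsD (OepsZ detD1^-1 (OepsMb (jet0O jv) jet_num01))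
  (OepsZ (T lc 0 1 / 2) (OepsM v1 (Oeps_eps lc 2)))) => x.
by move: (udet x)^-1 => v; field.
Qed.

(** The factor [x - lc] cancels the pole from [\det D = detD1 * eps * udet], leaving the quantities
    expanded above. *)
Lemma theta_sigmaE x : x != lc -> D x \in unitmx ->
  [/\ 2 * (x - lc) * convergence (deformation x) =
        detD1^-1 * (num00 x + num11 x) * (udet x)^-1,
      2 * (x - lc) * complex.Re (shear (deformation x)) =
        detD1^-1 * (num11 x - num00 x) * (udet x)^-1 &
      (x - lc) * complex.Im (shear (deformation x)) = detD1^-1 * num01 x * (udet x)^-1].
Proof.
move=> xc Du; have [S00 S01 S11] := deformation_entries Du.
have Q0 := detD1_neq0.
have d0 : \det (D x) != 0 by rewrite -unitfE -unitmxE.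
have u0 : udet x != 0 by apply: contraNneq d0 => u0; rewrite detD_udet u0 mulr0.
rewrite /convergence /shear /= S00 S01 S11 detD_udet.
by split; field; rewrite ?Q0 ?u0 ?subr_eq0 ?xc.
Qed.
End Conjugate.

(** * The numbers [a] and [b] in terms of [D'] *)

Section ComplexDerivatives.
Variables (R : realType) (J : set R) (T D D' : R -> 'M[R]_2) (lc : R) (a b : R[i]).
Hypothesis derD : is_derive_on J D D'.
Hypothesis Jlc : J^° lc.
Hypothesis cLam : is_cderive (fun x => Lam (D x)) lc (a * Lam (D lc)).
Hypothesis cGam : is_cderive (fun x => Gam (D x)) lc (b * Lam (D lc)).

(** [Lam] and [Gam] are real-linear in the entries, so uniqueness of derivatives identifies both
    sides. *)
Lemma Lam_Gam_derive : Lam (D' lc) = a * Lam (D lc) /\ Gam (D' lc) = b * Lam (D lc).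
Proof.
have d i j := is_derive_on_entry i j derD Jlc.
have cst2 : is_derive (lc : R) (1 : R) (fun=> 2^-1 : R) 0 by exact: is_derive_cst.
have [Lr Li] := is_cderive_parts cLam; have [Gr Gi] := is_cderive_parts cGam.
have := is_deriveM (is_deriveD (d 0 0) (d 1 1)) cst2.
have := is_deriveM (is_deriveB (d 0 1) (d 1 0)) cst2.
have := is_deriveM (is_deriveB (d 0 0) (d 1 1)) cst2.
have := is_deriveM (is_deriveD (d 0 1) (d 1 0)) cst2.
move=> gi gr li lr.
have eqd (f : R -> R) (u v : R) : is_derive (lc : R) (1 : R) f u ->
  is_derive (lc : R) (1 : R) f v -> u = v by move=> [_ <-] [_ <-].
have := eqd _ _ _ Lr lr; have := eqd _ _ _ Li li.
have := eqd _ _ _ Gr gr; have := eqd _ _ _ Gi gi.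
rewrite /GRing.scale /= => e4 e3 e2 e1.
split; apply/eqP; rewrite eq_complex; apply/andP; split; apply/eqP.
- by rewrite e1 /=; lra.
- by rewrite e2 /=; lra.
- by rewrite e3 /=; lra.
- by rewrite e4 /=; lra.
Qed.
End ComplexDerivatives.

(** * From entrywise expansions to the complex and optical quantities *)

Theorem mainTheorem3 (R : realType) :
  exists k0 : nat, forall k : nat, (k0 <= k)%N ->
  forall (J : set R) (T D D' : R -> 'M[R]_2) (lc : R) (a b : R[i]),
  is_interval J -> J 0 -> (forall x, J x -> 0 <= x) ->
  (forall x, J x -> (T x)^T = T x) -> C_on k J T ->
  is_derive_on J D D' -> is_derive_on J D' (fun x => T x *m D x) ->
  D 0 = 0 -> D' 0 = 1%:M ->
  0 < lc -> J^° lc -> \rank (D lc) = 1%N ->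
  let Lc := Lam (D lc) in
  Gam (D lc) = Lc -> Lc != 0 ->
  is_cderive (fun x => Lam (D x)) lc (a * Lc) ->
  is_cderive (fun x => Gam (D x)) lc (b * Lc) ->
  let eps := (fun x : R => x - lc) in
  let Rc := convergence (T lc) in
  let Fc := shear (T lc) in
  let S := (fun x => D' x *m invmx (D x)) in
  let theta := (fun x => convergence (S x)) in
  let sigma := (fun x => shear (S x)) in
  let detD := (fun x => \det (D x)) in
  let w := (fun x => signed_sqrt (detD x)) in
  let q : R := complex.Re (a - b) in
  let p : R := normc a ^+ 2 - normc b ^+ 2 in
  let kappa : R := p / (2 * q) in
  complex.Im (a + b) = 0 /\ q%:C = a - b^* /\ q != 0
  /\ toC (fun x => Lam (D x)
       - (1 + a * (eps x)%:C + ((eps x ^+ 2) / 2)%:C * (Rc%:C - Fc)) * Lc)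
       =O_ (nbhs lc) toC (fun x => (eps x ^+ 3)%:C)
  /\ toC (fun x => Gam (D x)
       - (1 + b * (eps x)%:C + ((eps x ^+ 2) / 2)%:C * (Rc%:C - Fc^*)) * Lc)
       =O_ (nbhs lc) toC (fun x => (eps x ^+ 3)%:C)
  /\ (fun x => detD x - (2 * q * normc Lc ^+ 2 * eps x
                         + p * normc Lc ^+ 2 * eps x ^+ 2))
       =O_ (nbhs lc) (fun x => eps x ^+ 3)
  /\ has_leading_order detD lc 1
  /\ (forall x, J x -> D x \in unitmx ->
       S x = optical_mx (theta x) (sigma x))
  /\ (exists2 r : R -> R, r =O_ (lc^') (fun x => eps x ^+ 2) &
       \forall x \near lc^',
         theta x = (2 * eps x)^-1 * (1 + kappa * eps x + r x))
  /\ (exists2 r : R -> R[i], toC r =O_ (lc^') toC (fun x => (eps x ^+ 2)%:C) &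
       \forall x \near lc^',
         sigma x = ((2 * eps x)^-1)%:C * (1 - (kappa * eps x)%:C + r x))
  /\ (fun x => complex.Im (sigma x)) =O_ (lc^') eps
  /\ (exists2 s1 : R,
       (fun x => complex.Im (sigma x) - s1 * eps x)
         =O_ (lc^') (fun x => eps x ^+ 2) &
       (s1 != 0 <-> complex.Im Fc != 0))
  (* sqrt (1 + kappa eps + O(eps^2)) = 1 + kappa/2 eps + O(eps^2): the linear
     term does not vanish in general, e.g. T = diag(0, -1), lc = pi *)
  /\ (exists2 r : R -> R, r =O_ (nbhs lc) (fun x => eps x ^+ 2) &
       \forall x \near lc,
         w x = normc Lc * Num.sg (q * eps x) * Num.sqrt `|2 * q * eps x|
               * (1 + kappa / 2 * eps x + r x))
  /\ derivable detD lc 1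
  /\ (let dc := derive1 detD lc in
      exists2 r : R -> R, r =O_ (nbhs lc) (fun x => eps x ^+ 2) &
       \forall x \near lc,
         w x = Num.sg (dc * eps x) * Num.sqrt `|dc * eps x|
               * (1 + kappa / 2 * eps x + r x))
  /\ {for lc, continuous w}
  /\ (((\forall x \near lc^'-, w x < 0) /\ (\forall x \near lc^'+, 0 < w x))
      \/ ((\forall x \near lc^'-, 0 < w x) /\ (\forall x \near lc^'+, w x < 0)))
  /\ (((fun x => (w x - w lc) / (x - lc)) @ lc^' --> +oo)
      \/ ((fun x => (w x - w lc) / (x - lc)) @ lc^' --> -oo)).
Proof.
(* One derivative of [T] on [J] both bounds [T] on compact segments and gives its expansion at
   [lc]. *)
exists 1%N => -[//|k] _ J T D D' lc [a1 a2] [b1 b2] itvJ J0 J_ge0 symT CT derD derD' D0 D'0.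
move=> lc0 Jlc _ Lc GL Lc0 cLam cGam eps Rc Fc S theta sigma detD w q p kappa.
have [LD GD] := Lam_Gam_derive derD Jlc cLam cGam.
(* The real and imaginary parts of [Gam (D lc) = Lam (D lc)] annihilate the second row. *)
have D11 : D lc 1 1 = 0.
  by have := congr1 (@complex.Re R) GL; rewrite /Lc /=; lra.
have D10 : D lc 1 0 = 0.
  by have := congr1 (@complex.Im R) GL; rewrite /Lc /=; lra.
have Dlc0 : (D lc 0 0, D lc 0 1) != (0, 0).
  apply: contra Lc0 => /eqP[x0 y0]; rewrite /Lc /Lam x0 y0 D11 D10.
  by rewrite addr0 subr0 mul0r.
pose X := D lc 0 0 / 2; pose Y := D lc 0 1 / 2.
have LcE : Lc = X +i* Y by rewrite /Lc /Lam D11 D10 addr0 subr0.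
have eX : D lc 0 0 = 2 * X by rewrite /X; field.
have eY : D lc 0 1 = 2 * Y by rewrite /Y; field.
have W := wronskian_lc itvJ J0 J_ge0 symT derD derD' D0 Jlc D10 D11.
rewrite -/Lc LcE in LD GD.
have L1 := congr1 (@complex.Re R) LD; have L2 := congr1 (@complex.Im R) LD.
have G1 := congr1 (@complex.Re R) GD; have G2 := congr1 (@complex.Im R) GD.
rewrite /= in L1 L2 G1 G2.
(* Solving the real and imaginary parts of [a * Lc] and [b * Lc] for the entries of [D' lc]. *)
have m00 : D' lc 0 0 = (a1 * X - a2 * Y) + (b1 * X - b2 * Y) by lra.
have m11 : D' lc 1 1 = (a1 * X - a2 * Y) - (b1 * X - b2 * Y) by lra.
have m01 : D' lc 0 1 = (a1 * Y + a2 * X) + (b1 * Y + b2 * X) by lra.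
have m10 : D' lc 1 0 = (b1 * Y + b2 * X) - (a1 * Y + a2 * X) by lra.
have NL : normc Lc ^+ 2 = X ^+ 2 + Y ^+ 2 by rewrite normc_sqr LcE.
have nL0 : normc Lc != 0 by apply: contraNneq Lc0 => /eq0_normc->.
have NL0 : X ^+ 2 + Y ^+ 2 != 0 by rewrite -NL expf_neq0.
(* In these coordinates [W] says that [a2 + b2] times the squared modulus of [Lc] is zero. *)
have Im0 : a2 + b2 = 0.
  apply: (mulIf NL0); rewrite mul0r; move: W; rewrite eX eY m01 m00; lra.
have Qneq0 := detD1_neq0 itvJ J0 J_ge0 symT CT derD derD' D0 D'0 Jlc D10 D11 Dlc0.
have qE : q = a1 - b1 by [].
have pE : p = a1 ^+ 2 + a2 ^+ 2 - (b1 ^+ 2 + b2 ^+ 2) by rewrite /p !normc_sqr.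
have QE : detD1 D D' lc = 2 * q * normc Lc ^+ 2.
  by rewrite /detD1 eX eY m11 m10 NL qE; ring.
have PE : detD2 D' lc = p * normc Lc ^+ 2.
  by rewrite /detD2 m00 m11 m01 m10 NL pE; ring.
have q0 : q != 0 by apply: contraNneq Qneq0 => q0; rewrite QE q0; apply/eqP; ring.
have kE : kap D D' lc = kappa.
  rewrite /kap QE PE /kappa; by field; rewrite q0 nL0.
have jdet := jet_detD symT CT derD derD' Jlc D10 D11.
have jD i j := jetD_entry CT derD derD' Jlc i j.
split; first by rewrite /= Im0.
split.
  by apply/eqP; rewrite eq_complex /= qE; apply/andP; split; apply/eqP; lra.
split; first by [].
split.
  apply: Oeps_bigO_complex.
  - apply: Oeps_ext (jetZ 2^-1 (jetD (jD 0 0) (jD 1 1))) => x.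
    rewrite /D2 D10 D11 m00 m11 eX eY LcE /Fc /Rc /eps /convergence /shear /Lam/=.
    rewrite ?(T10E symT (interior_subset Jlc)).
    by field.
  - apply: Oeps_ext (jetZ 2^-1 (jetB (jD 0 1) (jD 1 0))) => x.
    rewrite /D2 D10 D11 m01 m10 eX eY LcE /Fc /Rc /eps /convergence /shear /Lam/=.
    rewrite ?(T10E symT (interior_subset Jlc)).
    by field.
split.
  apply: Oeps_bigO_complex.
  - apply: Oeps_ext (jetZ 2^-1 (jetB (jD 0 0) (jD 1 1))) => x.
    rewrite /D2 D10 D11 m00 m11 eX eY LcE /Fc /Rc /eps /convergence /shear /Lam/=.
    rewrite ?(T10E symT (interior_subset Jlc)).
    by field.
  - apply: Oeps_ext (jetZ 2^-1 (jetD (jD 0 1) (jD 1 0))) => x.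
    rewrite /D2 D10 D11 m01 m10 eX eY LcE /Fc /Rc /eps /convergence /shear /Lam/=.
    rewrite ?(T10E symT (interior_subset Jlc)).
    by field.
split.
  apply: Oeps_bigO; apply: Oeps_ext jdet => x.
  by rewrite QE PE /eps /detD; ring.
split.
  exists (detD1 D D' lc) => //.
  by under eq_fun do rewrite expr1; exact: jet_cvg_slope jdet.
split.
  move=> x Jx Dx; apply/optical_mxE.
  exact: (deformation_sym itvJ J0 J_ge0 symT derD derD' D0).
have ts :=
  theta_sigmaE itvJ J0 J_ge0 symT CT derD derD' D0 D'0 Jlc D10 D11 Dlc0.
have Du := D_unit itvJ J0 J_ge0 symT CT derD derD' D0 D'0 Jlc D10 D11 Dlc0.
have jth := jet_theta itvJ J0 J_ge0 symT CT derD derD' D0 D'0 Jlc D10 D11 Dlc0.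
have jsg := jet_sigma itvJ J0 J_ge0 symT CT derD derD' D0 D'0 Jlc D10 D11 Dlc0.
have jn := Oeps_num01 itvJ J0 J_ge0 symT CT derD derD' D0 D'0 Jlc D10 D11 Dlc0.
have ju := jet_udet itvJ J0 J_ge0 symT CT derD derD' D0 D'0 Jlc D10 D11 Dlc0.
have u0 := udet_gt0 itvJ J0 J_ge0 symT CT derD derD' D0 D'0 Jlc D10 D11 Dlc0.
have du := detD_udet itvJ J0 J_ge0 symT CT derD derD' D0 D'0 Jlc D10 D11 Dlc0.
have dlc := detD_lc D10 D11.
rewrite kE in jth jsg ju.
split.
  (* The remainder is found by solving the claimed equation; off [lc] it is the error in [jth]. *)
  exists (fun x => 2 * eps x * theta x - 1 - kappa * eps x).
    have [|K thK] := Oeps_dnbhs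
      (f := fun x => 2 * eps x * theta x - 1 - kappa * eps x) _ jth; last exact: bigO_real thK.
    near=> x; move=> xc; have [|<- _ _] := ts x xc; first by move: xc; near: x.
    by rewrite /theta /eps; ring.
  rewrite near_withinE; near=> x; move=> xc.
  by rewrite /eps; field; rewrite subr_eq0.
(* Off [lc] this is [eps] times the imaginary part of [sigma], which is therefore absorbed by the
   remainder of [sigma]. *)
have gO : Oeps lc 2 (fun x => (detD1 D D' lc)^-1 * num01 D D' x * (udet D D' lc x)^-1).
  apply: Oeps_ext (OepsD (Oeps_le (isT : (2 <= 3)%N) jn)
    (OepsZ (T lc 0 1 / 2) (Oeps_eps lc 2))) => x.
  by rewrite subrK.
split.
  exists (fun x => (2 * eps x)%:C * sigma x - 1 + (kappa * eps x)%:C).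
    have [|K reK] := Oeps_dnbhs (f := fun x => complex.Re
      ((2 * eps x)%:C * sigma x - 1 + (kappa * eps x)%:C)) _ jsg.
      near=> x; move=> xc; have [|_ <- _] := ts x xc; first by move: xc; near: x.
      by rewrite /sigma /eps /=; ring.
    have [|L imL] := Oeps_dnbhs (f := fun x => complex.Im
      ((2 * eps x)%:C * sigma x - 1 + (kappa * eps x)%:C)) _ (OepsZ 2 gO).
      near=> x; move=> xc; have [|_ _ <-] := ts x xc; first by move: xc; near: x.
      by rewrite /sigma /eps /=; ring.
    exact: bigO_complex reK imL.
  rewrite near_withinE; near=> x; move=> xc.
  have e0 : (2 * eps x)%:C != 0 :> R[i].
    by rewrite fmorph_eq0 mulf_neq0 ?subr_eq0// pnatr_eq0.
  rewrite fmorphV; set e := (2 * eps x)%:C in e0 *.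
  have -> : 1 - (kappa * eps x)%:C + (e * sigma x - 1 + (kappa * eps x)%:C) = e * sigma x.
    by ring.
  by rewrite mulKf.
split.
  have [|K imK] := Oeps_dnbhs (f := fun x => complex.Im (sigma x)) _ (Oeps_divr gO).
    near=> x; move=> xc; have [|_ _ <-] := ts x xc; first by move: xc; near: x.
    by rewrite mulrC mulKf// subr_eq0.
  apply: (@bigO_real _ _ _ _ K); apply: filterS imK => x.
  by rewrite expr1.
split.
  (* The first-order coefficient is half the imaginary part of [Fc], since that part is
     [T lc 0 1]. *)
  exists (T lc 0 1 / 2); last by rewrite /Fc /= mulf_eq0 invr_eq0 pnatr_eq0 orbF.
  have [|K imK] := Oeps_dnbhs
    (f := fun x => complex.Im (sigma x) - T lc 0 1 / 2 * eps x) _ (Oeps_divr jn).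
    near=> x; move=> xc; have [|_ _ <-] := ts x xc; first by move: xc; near: x.
    by rewrite /eps; field; rewrite subr_eq0.
  exact: bigO_real imK.
(* Positivity of [udet] lets it leave the signed root as an ordinary square root. *)
have wE : \forall x \near lc,
    w x = signed_sqrt (detD1 D D' lc * eps x) * Num.sqrt (udet D D' lc x).
  near=> x; have ux : 0 < udet D D' lc x by near: x.
  by rewrite /w /detD du signed_sqrtM.
have rO := Oeps_bigO (jet_sqrt ju).
split.
  (* The error of [jet_sqrt] for [udet] serves both formulas for [w], which differ only in how
     [detD1] is written. *)
  exists (fun x => Num.sqrt (udet D D' lc x) - (1 + kappa / 2 * (x - lc) + 0 * (x - lc) ^+ 2)).
    exact: rO.
  near=> x; have -> : w x = signed_sqrt (detD1 D D' lc * eps x) * Num.sqrt (udet D D' lc x).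
    by near: x.
  congr (_ * _); last by rewrite /eps; ring.
  rewrite QE; have -> : 2 * q * normc Lc ^+ 2 * eps x = (2 * q * eps x) * normc Lc ^+ 2 by ring.
  rewrite signed_sqrtM ?exprn_gt0 ?lt0r ?nL0 ?normc_ge0//.
  rewrite sqrtr_sqr (ger0_norm (normc_ge0 _)) /signed_sqrt mulrC mulrA -[2 * q * _]mulrA.
  by rewrite sgrM gtr0_sg// mul1r.
have dd : is_derive (lc : R) (1 : R) detD (detD1 D D' lc) := jet_is_derive jdet dlc.
split; first by have [] := dd.
split.
  rewrite /= derive1E derive_val.
  exists (fun x => Num.sqrt (udet D D' lc x) - (1 + kappa / 2 * (x - lc) + 0 * (x - lc) ^+ 2)).
    exact: rO.
  near=> x; have -> : w x = signed_sqrt (detD1 D D' lc * eps x) * Num.sqrt (udet D D' lc x).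
    by near: x.
  by congr (_ * _); rewrite /eps; ring.
have wc : {for lc, continuous w}.
  apply: signed_sqrt_continuous => //.
  by apply: differentiable_continuous; apply/derivable1_diffP; have [] := dd.
split => //.
have [Q0|Q0|Q0] := ltgtP 0 (detD1 D D' lc); last by rewrite -Q0 eqxx in Qneq0.
- split; left; first exact: signed_sqrt_cross Q0 jdet.
  exact: signed_sqrt_slope Q0 dlc jdet.
(* For negative Q the positive case applies to [- \det D], as [signed_sqrt] is odd. *)
- have jN := jetZ (-1) jdet; rewrite mulr0 in jN.
  have QN : 0 < -1 * detD1 D D' lc by rewrite mulN1r oppr_gt0.
  have wN x : w x = - signed_sqrt (-1 * \det (D x)).
    by rewrite mulN1r signed_sqrtN opprK.
  split; right.
  + have [h1 h2] := signed_sqrt_cross QN jN; split.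
    * by apply: filterS h1 => x; rewrite wN oppr_gt0.
    * by apply: filterS h2 => x; rewrite wN oppr_lt0.
  + have := signed_sqrt_slope QN _ jN; rewrite dlc mulr0 => /(_ erefl).
    move=> h; apply/cvgNry; apply: cvg_trans h; apply: near_eq_cvg; near=> x.
    by rewrite !fctE !wN dlc mulr0; ring.
Unshelve. all: by end_near. Qed.
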